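(* Let $X_1,X_2,\ldots$ be independent and identically distributed random variables with common distribution $F\in\mathcal{A}$. Let $N$ be a random variable with values in $\{0,1,2,\ldots\}$, $\mathbf{P}[N=0]<1$, independent of $X_1,X_2,\ldots$, with $\mathbf{E}[N]<\infty$ and such that $\mathbf{E}[(1+\delta)^N]<\infty$ for some $\delta>0$. Let $F_{S_N}$ be the distribution of $S_N:=\sum_{i=1}^NX_i$ (with $S_0:=0$). Then $$\overline F_{S_N}(x)\sim\mathbf{E}[N]\,\overline F(x),\qquad x\to\infty,$$ and $F_{S_N}\in\mathcal{A}$.
   Context: For a distribution $F$, $\overline F(x)=1-F(x)$ denotes its tail; $\overline F(x)>0$ for every $x\ge0$. The relation $\sim$ means that the ratio of the two sides tends to $1$. Classes of distributions (on $\mathbb{R}$): - $F\in\mathcal{P_D}$ (positively decreasing) if $\limsup_{x\to\infty}\overline F(vx)/\overline F(x)<1$ for some $v>1$. - $F\in\mathcal{L}$ (long-tailed) if $\lim_{x\to\infty}\overline F(x-y)/\overline F(x)=1$ for every $y\ne 0$. - $F\in\mathcal{S}$ (subexponential) if $F\in\mathcal{L}$ and $\lim_{x\to\infty}\overline{F^{*2}}(x)/\overline F(x)=2$, where $F^{*2}$ is the convolution of $F$ with itself. - $\mathcal{A}:=\mathcal{S}\cap\mathcal{P_D}$. *)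

(* Defs.v *)
From HB Require Import structures.
From mathcomp Require Import all_boot all_order all_algebra finmap.
From mathcomp Require Import all_classical all_reals all_analysis.
From mathcomp Require Import measurable_realfun.
Import Order.TTheory GRing.Theory Num.Theory.
Import numFieldNormedType.Exports.

Set Implicit Arguments.
Unset Strict Implicit.
Unset Printing Implicit Defensive.

Local Open Scope classical_set_scope.
Local Open Scope ring_scope.

Section Distributions.
Context {R : realType}.
Implicit Types F G : probability R R.

Definition tail F (x : R) : R := 1 - fine (F `]-oo, x]%classic).

(* Standing assumption on every distribution considered.  It is built into
   [positively_decreasing] and [long_tailed]: since [a / 0 = 0], every
   distribution with support bounded above would otherwise be positively
   decreasing. *)
Definition positive_tail F : Prop := forall x : R, 0 <= x -> 0 < tail F x.

Definition asymp_equiv (f g : R -> R) : Prop :=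
  f x / g x @[x --> +oo] --> (1 : R).

Definition sum_pair (z : R * R) : R := z.1 + z.2.

Lemma measurable_sum_pair : measurable_fun [set: _] sum_pair.
Proof. exact: measurable_funD. Qed.

HB.instance Definition _ := isMeasurableFun.Build _ _ _ _ sum_pair
  measurable_sum_pair.

Definition convolution F G : probability R R :=
  distribution (F \x G)%E sum_pair.

Definition positively_decreasing F : Prop :=
  positive_tail F /\
  exists2 v : R, 1 < v &
    (limf_esup (fun x : R => (tail F (v * x) / tail F x)%:E) (pinfty_nbhs R)
      < 1)%E.

Definition long_tailed F : Prop :=
  positive_tail F /\
  forall y : R, y != 0 -> tail F (x - y) / tail F x @[x --> +oo] --> (1 : R).

Definition subexponential F : Prop :=
  long_tailed F /\
  tail (convolution F F) x / tail F x @[x --> +oo] --> (2 : R).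

Definition class_A F : Prop := subexponential F /\ positively_decreasing F.

End Distributions.

Section RandomSum.
Context {d : measure_display} {T : measurableType d} {R : realType}.
Variable P : probability T R.

Definition mutually_independent (X : nat -> {RV P >-> R}) : Prop :=
  forall (J : {fset nat}) (B : nat -> set R),
    (forall i, measurable (B i)) ->
    P (\bigcap_(i in [set` J]) (X i @^-1` B i)) =
    (\prod_(i <- J) P (X i @^-1` B i))%E.

Definition sigma_seq (X : nat -> {RV P >-> R}) : set (set T) :=
  <<s \bigcup_i preimage_set_system [set: T] (X i) measurable >>.

Definition independent_of_seq (N : {RV P >-> nat})
    (X : nat -> {RV P >-> R}) : Prop :=
  forall (C : set nat) (E : set T), sigma_seq X E ->
    P ((N @^-1` C) `&` E) = (P (N @^-1` C) * P E)%E.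

(* [X i] stands for X_(i+1). *)
Definition random_sum (X : nat -> {RV P >-> R})
    (N : {RV P >-> nat}) (w : T) : R :=
  \sum_(i < N w) X i w.

Lemma measurable_random_sum X N : measurable_fun [set: T] (random_sum X N).
Proof.
move=> _ B mB; rewrite setTI.
have -> : random_sum X N @^-1` B =
    \bigcup_n ((N @^-1` [set n]) `&` ((fun w => \sum_(i < n) X i w) @^-1` B)).
  apply/seteqP; split => [w /= Bw | w [n _ [/= <- //]]].
  by exists (N w).
apply: bigcup_measurable => n _; apply: measurableI.
  by rewrite -[X in measurable X]setTI; exact: measurable_funP.
rewrite -[X in measurable X]setTI.
have mS : measurable_fun [set: T]
      (fun w => \sum_(i < n) X i w : R).
  by apply: measurable_sum => i; exact: measurable_funP.
exact: mS.
Qed.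

HB.instance Definition _ X N := isMeasurableFun.Build _ _ _ _ (random_sum X N)
  (measurable_random_sum X N).

End RandomSum.

(* Main.v *)
(* One big jump.  For G1, G2 whose tails are asymptotic to c1 and c2 times the
   tail of a subexponential F, the event {y + z > x} splits into {y <= A},
   {z <= A} and {y, z > A}.  Long-tailedness gives the first two parts the
   asymptotics c2 and c1 times the tail of F; the third is at most a
   constant times the mass of that event under F x F, which the
   subexponentiality of F makes negligible as A grows.  Hence the convolution of G1 and G2 has tail
   asymptotic to c1 + c2 times that of F, and the n-th convolution power of F
   has tail asymptotic to n times that of F.  Kesten's bound K (1 + delta)^n
   for these ratios lets dominated convergence sum over the law of N.  Finally
   the class A is closed under tail equivalence, subexponentiality following
   from the first step with G1 = G2. *)

Require Import Defs.
From HB Require Import structures.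
From mathcomp Require Import all_boot all_order all_algebra finmap.
From mathcomp Require Import all_classical all_reals all_analysis.
From mathcomp Require Import ring lra measurable_realfun.
Import Order.TTheory GRing.Theory Num.Theory.
Import numFieldNormedType.Exports.

Local Open Scope classical_set_scope.
Local Open Scope ring_scope.

(** * Tails of convolutions as product measures of planar regions *)

Section Tails.
Context {R : realType}.
Implicit Types F G H : probability R R.

Lemma tailE F x : (tail F x)%:E = F `]x, +oo[%classic.
Proof.
rewrite /tail EFinB fineK ?fin_num_measure// -probability_setC//.
by rewrite setCitvl.
Qed.

Lemma tail_ge0 F x : 0 <= tail F x.
Proof. by rewrite -lee_fin tailE measure_ge0. Qed.

Lemma tail_le1 F x : tail F x <= 1.
Proof. by rewrite -lee_fin tailE probability_le1. Qed.

Lemma tail_nonincreasing F : {homo tail F : x y / x <= y >-> y <= x}.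
Proof.
move=> x y xy; rewrite -lee_fin !tailE le_measure ?inE//.
by apply: subset_itvr; rewrite bnd_simp.
Qed.

Lemma tail_gt0 F x : positive_tail F -> 0 < tail F x.
Proof.
move=> F0; have [x0|x0] := leP 0 x; first exact: F0.
by rewrite (lt_le_trans (F0 0 (lexx _)))// tail_nonincreasing// ltW.
Qed.

Lemma measurable_sum_gt (x : R) : measurable [set z : R * R | x < z.1 + z.2].
Proof.
have /(_ measurableT _ (measurable_itv `]x, +oo[)) := @measurable_sum_pair R.
rewrite setTI; congr (measurable _).
by apply/seteqP; split=> z /=; rewrite in_itv/= andbT.
Qed.

Lemma tail_convolution F G x :
  (tail (convolution F G) x)%:E = (F \x G)%E [set z | x < z.1 + z.2].
Proof.
rewrite tailE /convolution /distribution /= /pushforward; congr (_ _).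
by apply/seteqP; split=> z /=; rewrite in_itv/= andbT.
Qed.

Lemma product_probability_fin_num F G (E : set (R * R)) :
  measurable E -> ((F \x G)%E E \is a fin_num).
Proof.
move=> mE; rewrite ge0_fin_numE ?measure_ge0// (@le_lt_trans _ _ 1%E) ?ltry//.
exact: (probability_le1 ((F \x G)%E : probability _ R)).
Qed.

(** By Fubini: each nonempty section is a half-line starting at or beyond [B], so its mass is a tail
    to which the domination applies. This replaces the second factor of a product while the first
    stays fixed. *)
Lemma xsection_half_line_le F G H (B a : R) (E : set (R * R)) :
  measurable E -> 0 <= a ->
  (forall z, B <= z -> tail G z <= a * tail H z) ->
  (forall y, xsection E y = set0 \/
    exists2 z, B <= z & xsection E y = `]z, +oo[%classic) ->
  ((F \x G)%E E <= a%:E * (F \x H)%E E)%E.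
Proof.
move=> mE a0 GH EH; rewrite /product_measure1 -ge0_integralZl//; last first.
  exact: measurable_fun_xsection.
apply: ge0_le_integral => //.
- exact: measurable_fun_xsection.
- by apply: measurable_funeM; exact: measurable_fun_xsection.
move=> y _ /=; have [->|[z Bz ->]] := EH y; first by rewrite !measure0 mule0.
by rewrite -!tailE lee_fin GH.
Qed.

(** Either factor can serve as the inner one of the iterated integral; through y-sections the first
    factor can be replaced as well. *)
Lemma product_measure12 F G (E : set (R * R)) : measurable E ->
  (F \x G)%E E = (F \x^ G)%E E.
Proof.
move=> mE; apply: product_measure_unique => // A B mA mB.
exact: product_measure2E.
Qed.

Lemma ysection_half_line_le F G H (B a : R) (E : set (R * R)) :
  measurable E -> 0 <= a ->
  (forall z, B <= z -> tail G z <= a * tail H z) ->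
  (forall y, ysection E y = set0 \/
    exists2 z, B <= z & ysection E y = `]z, +oo[%classic) ->
  ((G \x F)%E E <= a%:E * (H \x F)%E E)%E.
Proof.
move=> mE a0 GH EH; rewrite !product_measure12// /product_measure2.
rewrite -ge0_integralZl//; last first.
  exact: measurable_fun_ysection.
apply: ge0_le_integral => //.
- exact: measurable_fun_ysection.
- by apply: measurable_funeM; exact: measurable_fun_ysection.
move=> y _ /=; have [->|[z Bz ->]] := EH y; first by rewrite !measure0 mule0.
by rewrite -!tailE lee_fin GH.
Qed.

(** The part of the event that a single large summand does not explain. *)
Definition both_large (A x : R) : set (R * R) :=
  [set z | [/\ A < z.1, A < z.2 & x < z.1 + z.2]].

(** Here the second coordinate exceeds [A], so a comparison of tails beyond [A] suffices for it. *)
Definition first_far (A x : R) : set (R * R) :=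
  [set z | z.1 <= x - A /\ x < z.1 + z.2].

Lemma measurable_both_large A x : measurable (both_large A x).
Proof.
have -> : both_large A x =
    (`]A, +oo[%classic `*` `]A, +oo[%classic) `&` [set z | x < z.1 + z.2].
  apply/seteqP; split=> z /=; rewrite !in_itv/= !andbT.
    by move=> [? ? ?].
  by move=> [[? ?] ?].
by apply: measurableI; [exact: measurableX|exact: measurable_sum_gt].
Qed.

Lemma measurable_first_far A x : measurable (first_far A x).
Proof.
have -> : first_far A x =
    (`]-oo, x - A]%classic `*` setT) `&` [set z | x < z.1 + z.2].
  apply/seteqP; split=> z /=; rewrite !in_itv/=.
    by move=> [? ?].
  by move=> [[? ?] ?].
by apply: measurableI; [exact: measurableX|exact: measurable_sum_gt].
Qed.

(** If one summand is at most [A], the other exceeds [x - A]; the union bound over the three cases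
    gives the estimate. *)
Lemma convolution_tail_le_split F G A x :
  ((tail (convolution F G) x)%:E <=
   (tail F (x - A) + tail G (x - A))%:E + (F \x G) (both_large A x))%E.
Proof.
rewrite tail_convolution EFinD !tailE.
have mF : measurable (`]x - A, +oo[%classic `*` [set: R]) by exact: measurableX.
have mG : measurable ([set: R] `*` `]x - A, +oo[%classic) by exact: measurableX.
have mL := measurable_both_large A x.
have -> : F `]x - A, +oo[%classic = (F \x G)%E (`]x - A, +oo[%classic `*` setT).
  rewrite product_measure1E//.
  by rewrite [X in (_ * X)%E](_ : _ = 1%E) ?mule1//; exact: probability_setT.
have -> : G `]x - A, +oo[%classic = (F \x G)%E (setT `*` `]x - A, +oo[%classic).
  rewrite product_measure1E//.
  by rewrite [X in (X * _)%E](_ : _ = 1%E) ?mul1e//; exact: probability_setT.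
apply: le_trans; last first.
  apply: leeD; last exact: lexx.
  by apply: measureU2.
apply: le_trans; last by apply: measureU2 => //; exact: measurableU.
apply: le_measure; rewrite ?inE; [exact: measurable_sum_gt| |].
  by apply: measurableU => //; exact: measurableU.
move=> [y z] /= xyz; rewrite !in_itv/= !andbT.
have [yA|yA] := leP y A; first by left; right; split => //; lra.
have [zA|zA] := leP z A; first by left; left; split => //; lra.
by right; split.
Qed.

(** A summand above [x + A] and another in []-A, A]] still add up to more than [x]. With [0 <= x]
    the two strips are disjoint, and [both_large] avoids both, so the masses add up. *)
Lemma convolution_tail_ge_split F G A x : 0 <= x ->
  ((tail F (x + A))%:E * G `](- A)%R, A]%classic +
   F `](- A)%R, A]%classic * (tail G (x + A))%:E +
   (F \x G) (both_large A x) <= (tail (convolution F G) x)%:E)%E.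
Proof.
move=> x0; rewrite tail_convolution !tailE.
have mF : measurable
    (`]x + A, +oo[%classic `*` `](- A)%R, A]%classic : set (R * R)).
  exact: measurableX.
have mG : measurable
    (`](- A)%R, A]%classic `*` `]x + A, +oo[%classic : set (R * R)).
  exact: measurableX.
have mL := measurable_both_large A x.
rewrite -!product_measure1E// -!measureU//; last first.
- by apply/seteqP; split=> // -[y z] /=; rewrite !in_itv/= ?andbT; lra.
- apply/seteqP; split=> // -[y z] /=; rewrite /both_large !in_itv/= ?andbT.
  by move=> -[[|] [? ?] [? ? ?]]; lra.
- exact: measurableU.
apply: le_measure; rewrite ?inE; [|exact: measurable_sum_gt|].
  by apply: measurableU => //; exact: measurableU.
move=> [y z] /=; rewrite /both_large !in_itv/= ?andbT.
by move=> -[[[? ?]|[? ?]]|[? ? ?]]; lra.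
Qed.

(** The quadrant [y > x + A], [z > -A] lies in the event and, as [A >= 0], misses [first_far]. For
    [G = F] this bounds the mass of [first_far] from above. *)
Lemma convolution_tail_ge_first_far F G A x : 0 <= A ->
  ((F \x G) (first_far A x) + (tail F (x + A) * tail G (- A))%:E <=
   (tail (convolution F G) x)%:E)%E.
Proof.
move=> A0; rewrite tail_convolution EFinM !tailE -product_measure1E//.
have mF := measurable_first_far A x.
rewrite -measureU//; first last.
- apply/seteqP; split=> // -[y z] /=; rewrite /first_far !in_itv/= ?andbT. lra.
- exact: measurableX.
apply: le_measure; rewrite ?inE; [|exact: measurable_sum_gt|].
  by apply: measurableU => //; exact: measurableX.
move=> [y z] /=; rewrite /first_far !in_itv/= ?andbT. lra.
Qed.

Lemma convolution_tail_le_first_far F G A x :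
  ((tail (convolution F G) x)%:E <=
   (tail F (x - A))%:E + (F \x G) (first_far A x))%E.
Proof.
rewrite tail_convolution tailE.
have mF : measurable (`]x - A, +oo[%classic `*` [set: R]) by exact: measurableX.
have mL := measurable_first_far A x.
have -> : F `]x - A, +oo[%classic = (F \x G)%E (`]x - A, +oo[%classic `*` setT).
  rewrite product_measure1E//.
  by rewrite [X in (_ * X)%E](_ : _ = 1%E) ?mule1//; exact: probability_setT.
apply: le_trans; last by apply: measureU2.
apply: le_measure; rewrite ?inE; [exact: measurable_sum_gt|exact: measurableU|].
move=> [y z] /= xyz; rewrite /first_far !in_itv/= !andbT.
by have [yA|yA] := leP y (x - A); [right|left].
Qed.

(** The factors are replaced one after the other, each at the cost of [M]. The sections start at
    [max(A, x - y)], hence never before [A]. *)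
Lemma both_large_le F G H1 H2 A x M : 0 <= M ->
  (forall z, A <= z -> tail F z <= M * tail H1 z) ->
  (forall z, A <= z -> tail G z <= M * tail H2 z) ->
  ((F \x G) (both_large A x) <=
   (M ^+ 2)%:E * (H1 \x H2) (both_large A x))%E.
Proof.
move=> M0 FH GH; have mL := measurable_both_large A x.
have sec y : [set z | [/\ A < y, A < z & x < y + z]] = set0 \/
    exists2 z, A <= z &
      [set z | [/\ A < y, A < z & x < y + z]] = `]z, +oo[%classic.
  have [yA|yA] := leP y A.
    by left; apply/seteqP; split=> // z /= [? ? ?]; lra.
  right; exists (Num.max A (x - y)); first by rewrite le_max lexx.
  apply/seteqP; split=> z /=; rewrite in_itv/= andbT gt_max.
    by move=> [? ? ?]; apply/andP; split => //; lra.
  by move=> /andP[? ?]; split => //; lra.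
apply: le_trans.
  apply: (@xsection_half_line_le F G H2 A M) => // y.
  by rewrite xsectionE; exact: sec.
rewrite expr2 EFinM -muleA lee_wpmul2l ?lee_fin//.
apply: (@ysection_half_line_le H2 F H1 A M) => // y.
have -> : ysection (both_large A x) y =
    [set z | [/\ A < y, A < z & x < y + z]].
  rewrite ysectionE /both_large.
  by apply/seteqP; split=> z /= [? ? ?]; split => //; lra.
exact: sec.
Qed.

Lemma first_far_le F G H A x a : 0 <= a ->
  (forall z, A <= z -> tail G z <= a * tail H z) ->
  ((F \x G) (first_far A x) <= a%:E * (F \x H) (first_far A x))%E.
Proof.
move=> a0 GH; have mL := measurable_first_far A x.
apply: (@xsection_half_line_le F G H A a) => // y; rewrite xsectionE.
have [yA|yA] := leP y (x - A); last first.
  by left; apply/seteqP; split=> // z /= [/= ? ?]; lra.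
right; exists (x - y); first by lra.
apply/seteqP; split=> z /=; rewrite /first_far in_itv/= andbT.
  by move=> /= -[? ?]; lra.
by move=> ?; split => //=; lra.
Qed.

End Tails.

(** * Asymptotics of convolution tails: one big jump and the step of Kesten's bound *)

Section Asymptotics.
Context {R : realType}.
Implicit Types F G H : probability R R.

(** The identity as a random variable under [F] has [F] as its law, so limits of its cdf give limits
    of the tail. *)
Let idR : R -> R := idfun.

#[local] HB.instance Definition _ :=
  @isMeasurableFun.Build _ _ _ _ idR (@measurable_id _ _ setT).

Lemma tail_cvg0 F : tail F x @[x --> +oo] --> (0 : R).
Proof.
rewrite [X in _ --> X](_ : _ = 1 - 1 :> R); last by rewrite subrr.
apply: cvgB; first exact: cvg_cst.
exact/fine_cvg/(@cvg_cdfy1 _ _ _ F (idR : {RV F >-> R})).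
Qed.

Lemma tail_oppr_cvg1 F : tail F (- x) @[x --> +oo] --> (1 : R).
Proof.
rewrite [X in _ --> X](_ : _ = 1 - 0 :> R); last by rewrite subr0.
apply: cvgB; first exact: cvg_cst.
have /fine_cvg H := @cvg_cdfNy0 _ _ _ F (idR : {RV F >-> R}).
by move/cvgNy_compNP : H; exact.
Qed.

Lemma probability_itv_oc F (a b : R) : a <= b ->
  F `]a, b]%classic = (tail F a - tail F b)%:E.
Proof.
move=> ab; rewrite EFinB !tailE.
have -> : `]a, +oo[%classic = `]a, b]%classic `|` `]b, +oo[%classic :> set R.
  apply/seteqP; split=> x /=; rewrite !in_itv/= ?andbT.
    by move=> ax; have [xb|xb] := leP x b; [left|right]; rewrite ?ax.
  by move=> [/andP[]//|]; exact: le_lt_trans.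
rewrite measureU//; last first.
  apply/seteqP; split=> // x /= []; rewrite !in_itv/= andbT; lra.
by rewrite addeK// fin_num_measure.
Qed.

(** The bracket bounds the [F \x F] mass of [both_large]: the two strips are subtracted from the
    whole event. Relative to the tail of a subexponential [F] it tends to [2 - 2 q], where [q] is
    the mass of []-A, A]]. *)
Lemma convolution_tail_upper F G1 G2 A x M : 0 <= A -> 0 <= x -> 0 <= M ->
  (forall z, A <= z -> tail G1 z <= M * tail F z) ->
  (forall z, A <= z -> tail G2 z <= M * tail F z) ->
  tail (convolution G1 G2) x <= tail G1 (x - A) + tail G2 (x - A) +
    M ^+ 2 * (tail (convolution F F) x -
      (tail F (- A) - tail F A) * tail F (x + A) *+ 2).
Proof.
move=> A0 x0 M0 G1F G2F.
have NAA : - A <= A by lra.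
rewrite -lee_fin; apply: (le_trans (convolution_tail_le_split G1 G2 A x)).
apply: (le_trans (leeD (lexx _) (both_large_le G1 G2 F F A x M M0 G1F G2F))).
have := convolution_tail_ge_split F F A x x0.
have : ((F \x F) (both_large A x) \is a fin_num)%E.
  by apply: product_probability_fin_num; exact: measurable_both_large.
move=> /fineK <-; set k := fine _; rewrite !(probability_itv_oc F (- A) A NAA).
rewrite -!EFinM -!EFinD !lee_fin => k1; rewrite lerD2l ler_wpM2l ?sqr_ge0//.
by rewrite -mulr_natr; lra.
Qed.

Lemma convolution_tail_lower G1 G2 A x : 0 <= A -> 0 <= x ->
  tail G1 (x + A) * (tail G2 (- A) - tail G2 A) +
  (tail G1 (- A) - tail G1 A) * tail G2 (x + A) <= tail (convolution G1 G2) x.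
Proof.
move=> A0 x0; have NAA : - A <= A by lra.
rewrite -lee_fin.
apply: le_trans (convolution_tail_ge_split G1 G2 A x x0).
rewrite (probability_itv_oc G1 (- A) A NAA) (probability_itv_oc G2 (- A) A NAA).
by rewrite EFinD !EFinM leeDl.
Qed.

Lemma ratio_shift F G (c A : R) : long_tailed F ->
  tail G x / tail F x @[x --> +oo] --> c ->
  tail G (x + A) / tail F x @[x --> +oo] --> c.
Proof.
move=> [F0 FL] GF.
have Fgt0 x := tail_gt0 F x F0.
have FA : tail F (x + A) / tail F x @[x --> +oo] --> (1 : R).
  (* Long-tailedness speaks of nonzero shifts only, so the zero shift is treated apart. *)
  have [->|A0] := eqVneq A 0.
    under eq_fun do rewrite addr0 divff ?gt_eqF//.
    exact: cvg_cst.
  have := FL (- A); rewrite oppr_eq0 => /(_ A0).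
  by under eq_fun do rewrite opprK.
have GA : tail G (x + A) / tail F (x + A) @[x --> +oo] --> c.
  by rewrite (cvg_shiftr A (fun x => tail G x / tail F x)).
rewrite -(mulr1 c); apply: cvg_trans (cvgM GA FA).
apply: near_eq_cvg; near=> x.
by rewrite /= mulrA divfK// gt_eqF.
Unshelve. all: end_near. Qed.

Lemma ratio_limit_ge0 F G (c : R) :
  tail G x / tail F x @[x --> +oo] --> c -> 0 <= c.
Proof.
move=> GF; rewrite -(cvg_lim _ GF)//; apply: limr_ge.
  by apply/cvg_ex; exists c.
by near=> x; rewrite divr_ge0// tail_ge0.
Unshelve. all: end_near. Qed.

(** For fixed [A] the upper and lower bounds, divided by the tail of [F], converge as [x] grows; a
    large [A] brings both limits within [e] of [c1 + c2]. Zero limits are allowed, which serves the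
    point mass at 0. *)
Lemma convolution_tail_asymp F G1 G2 (c1 c2 : R) : subexponential F ->
  tail G1 x / tail F x @[x --> +oo] --> c1 ->
  tail G2 x / tail F x @[x --> +oo] --> c2 ->
  tail (convolution G1 G2) x / tail F x @[x --> +oo] --> c1 + c2.
Proof.
move=> [FL F2] G1F G2F; have F0 := FL.1.
have Fgt0 x := tail_gt0 F x F0.
have c10 := ratio_limit_ge0 _ _ _ G1F.
have c20 := ratio_limit_ge0 _ _ _ G2F.
apply/cvgrPdist_le => e e0.
(* [M] eventually bounds both ratios. The choice of [eta] makes the error at most
   [2 * M ^+ 2 * eta = e / 2] above, and at most [M ^+ 2 * eta = e / 4] below because
   [c1 + c2 <= M <= M ^+ 2]. *)
pose M := c1 + c2 + 1; have M1 : 1 <= M by rewrite /M; lra.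
have M20 : 0 < M ^+ 2 by rewrite exprn_gt0//; lra.
pose eta := e / (M ^+ 2 *+ 4).
have eta0 : 0 < eta by rewrite divr_gt0// mulrn_wgt0.
have etaM : M ^+ 2 * eta = e / 4.
  rewrite /eta -[M ^+ 2 *+ 4]mulr_natr mulrA; field.
  by rewrite gt_eqF//; lra.
have G1M : \forall x \near +oo, tail G1 x <= M * tail F x.
  near=> x; rewrite -ler_pdivrMr//; near: x; apply: (cvgr_le c1) => //.
  by rewrite /M; lra.
have G2M : \forall x \near +oo, tail G2 x <= M * tail F x.
  near=> x; rewrite -ler_pdivrMr//; near: x; apply: (cvgr_le c2) => //.
  by rewrite /M; lra.
case: G1M => A1 [_ G1M]; case: G2M => A2 [_ G2M].
have mass G : \forall A \near +oo, 1 - eta <= tail G (- A) - tail G A.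
  apply: (cvgr_ge (1 - 0)); last by lra.
  by apply: cvgB; [exact: tail_oppr_cvg1|exact: tail_cvg0].
(* [A] is fixed before [x]: past it both dominations hold, and all three laws give []-A, A]] mass at
   least [1 - eta]. *)
have [A [A0 AA1 AA2 [p pG1 pG2]]] : exists A, [/\ 0 <= A, A1 < A, A2 < A &
    [/\ 1 - eta <= tail F (- A) - tail F A,
       1 - eta <= tail G1 (- A) - tail G1 A &
       1 - eta <= tail G2 (- A) - tail G2 A]].
  near (pinfty_nbhs R) => A; exists A; split.
  - near: A; by apply: nbhs_pinfty_ge; exact: num_real.
  - near: A; by apply: nbhs_pinfty_gt; exact: num_real.
  - near: A; by apply: nbhs_pinfty_gt; exact: num_real.
  - by split; near: A; exact: mass.
pose q := tail F (- A) - tail F A; pose q1 := tail G1 (- A) - tail G1 A.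
pose q2 := tail G2 (- A) - tail G2 A.
have u : (tail G1 (x - A) / tail F x + tail G2 (x - A) / tail F x +
    M ^+ 2 * (tail (convolution F F) x / tail F x -
      q * (tail F (x + A) / tail F x) *+ 2)) @[x --> +oo] -->
    c1 + c2 + M ^+ 2 * (2 - q * 1 *+ 2).
  apply: cvgD; first by apply: cvgD; exact: ratio_shift.
  apply: cvgMr; apply: cvgB => //; apply: cvgMn; apply: cvgMr.
  apply: ratio_shift => //.
  under eq_fun do rewrite divff ?gt_eqF//.
  exact: cvg_cst.
have l : (tail G1 (x + A) / tail F x * q2 + q1 * (tail G2 (x + A) / tail F x))
    @[x --> +oo] --> c1 * q2 + q1 * c2.
  apply: cvgD; first by apply: cvgMl; exact: ratio_shift.
  by apply: cvgMr; exact: ratio_shift.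
have U : c1 + c2 + M ^+ 2 * (2 - q * 1 *+ 2) < c1 + c2 + e.
  have : M ^+ 2 * (2 - q * 1 *+ 2) <= M ^+ 2 * (eta * 2).
    by rewrite ler_pM2l// mulr1 -(mulr_natr q); move: p; rewrite -/q; lra.
  by rewrite mulrA etaM; lra.
have L : c1 + c2 - e < c1 * q2 + q1 * c2.
  have h1 : c1 * (1 - eta) <= c1 * q2 by rewrite ler_wpM2l.
  have h2 : (1 - eta) * c2 <= q1 * c2 by rewrite ler_wpM2r.
  have h3 : (c1 + c2) * eta <= M ^+ 2 * eta.
    rewrite ler_pM2r// (@le_trans _ _ M)//; first by rewrite /M; lra.
    by rewrite expr2 ler_peMr//; lra.
  by rewrite etaM in h3; lra.
have alg (a b m g h k i : R) : a * i + b * i + m * (g * i - k * (h * i) *+ 2) =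
    (a + b + m * (g - k * h *+ 2)) * i by ring.
near=> x; rewrite ler_distlC; apply/andP; split.
  apply: (@le_trans _ _ (tail G1 (x + A) / tail F x * q2 +
      q1 * (tail G2 (x + A) / tail F x))).
    by near: x; exact: (cvgr_ge _ l).
  rewrite ler_pdivlMr// mulrDl mulrAC divfK ?gt_eqF// -mulrA divfK ?gt_eqF//.
  exact: convolution_tail_lower.
apply: (@le_trans _ _ (tail G1 (x - A) / tail F x + tail G2 (x - A) / tail F x +
    M ^+ 2 * (tail (convolution F F) x / tail F x -
      q * (tail F (x + A) / tail F x) *+ 2))); last first.
  by near: x; exact: (cvgr_le _ u).
have -> : tail G1 (x - A) / tail F x + tail G2 (x - A) / tail F x +
    M ^+ 2 * (tail (convolution F F) x / tail F x -
      q * (tail F (x + A) / tail F x) *+ 2) =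
   (tail G1 (x - A) + tail G2 (x - A) + M ^+ 2 * (tail (convolution F F) x -
      q * tail F (x + A) *+ 2)) / tail F x.
  exact: alg.
rewrite ler_pM2r ?invr_gt0//.
apply: convolution_tail_upper => //.
- lra.
- by move=> z Az; apply: G1M; exact: lt_le_trans Az.
- by move=> z Az; apply: G2M; exact: lt_le_trans Az.
Unshelve. all: end_near. Qed.

(* Split the event {y + z > x} at y = x - A: the tail of G is replaced by that
   of a F only where y <= x - A, and the F x F mass of this part is
   asymptotically at most (1 + e) times the tail of F, not 2 times. *)
Lemma kesten_step F (e : R) : subexponential F -> 0 < e ->
  exists2 C, 0 <= C & forall G a, 0 <= a ->
    (forall z, tail G z <= a * tail F z) ->
    forall x, tail (convolution F G) x <= (C + (1 + e) * a) * tail F x.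
Proof.
move=> [FL F2] e0; have F0 := FL.1.
have Fgt0 x := tail_gt0 F x F0.
have [A [A0 Ae]] : exists A, 0 <= A /\ 1 - e / 2 <= tail F (- A).
  near (pinfty_nbhs R) => A; exists A; split.
    near: A; by apply: nbhs_pinfty_ge; exact: num_real.
  near: A; apply: (cvgr_ge _ (tail_oppr_cvg1 F)); lra.
have FF : tail F x / tail F x @[x --> +oo] --> (1 : R).
  under eq_fun do rewrite divff ?gt_eqF//.
  exact: cvg_cst.
(* The numerator dominates the [F \x F] mass of [first_far]; the limit is [2 - tail F (- A)], at
   most [1 + e / 2] by the choice of [A]. *)
have h1 : \forall x \near +oo, (tail (convolution F F) x -
    tail F (x + A) * tail F (- A)) / tail F x <= 1 + e.
  under eq_near do rewrite mulrBl mulrAC.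
  apply: (cvgr_le (2 - 1 * tail F (- A))); last by lra.
  by apply: cvgB => //; apply: cvgMl; exact: ratio_shift.
have h2 : \forall x \near +oo, tail F (x - A) / tail F x <= 2.
  by apply: (cvgr_le 1); [exact: ratio_shift|lra].
case: h1 => x1 [_ h1]; case: h2 => x2 [_ h2].
pose x0 := Num.max x1 x2.
(* Beyond [x0] the 2 absorbs the shifted tail of [F]; up to [x0] the ratio [tail F x / tail F x0] is
   at least 1. Neither [A] nor [x0] depends on [G] or [a], so the constant can be iterated. *)
exists (2 + (tail F x0)^-1); first by rewrite addr_ge0// invr_ge0 ltW.
move=> G a a0 GF x.
have a1 : 0 <= (1 + e) * a by rewrite mulr_ge0//; lra.
have [x0x|xx0] := ltP x0 x; last first.
  apply: (le_trans (tail_le1 _ _)); rewrite -addrA mulrDl.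
  apply: (@le_trans _ _ ((tail F x0)^-1 * tail F x)).
    by rewrite mulrC ler_pdivlMr// mul1r tail_nonincreasing.
  have := mulr_ge0 a1 (ltW (Fgt0 x)); have := Fgt0 x.
  by rewrite mulrDl; lra.
move: x0x; rewrite gt_max => /andP[x1x x2x].
have := h1 _ x1x; rewrite ler_pdivrMr// => {}h1.
have := h2 _ x2x; rewrite ler_pdivrMr// => {}h2.
have GF' : forall z, A <= z -> tail G z <= a * tail F z by move=> z _.
rewrite -lee_fin; apply: (le_trans (convolution_tail_le_first_far F G A x)).
apply: (le_trans (leeD (lexx _) (first_far_le F G F A x a a0 GF'))).
have /= := convolution_tail_ge_first_far F F A x A0.
have : ((F \x F) (first_far A x) \is a fin_num)%E.
  by apply: product_probability_fin_num; exact: measurable_first_far.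
move=> /fineK <-; set k := fine _; rewrite -EFinD -EFinM -EFinD !lee_fin => k1.
have : a * k <= a * ((1 + e) * tail F x) by rewrite ler_wpM2l//; lra.
have : 0 <= (tail F x0)^-1 * tail F x by rewrite mulr_ge0 ?invr_ge0 ?ltW.
nra.
Unshelve. all: end_near. Qed.

(** * Closure of the classes under tail equivalence *)

Lemma long_tailed_equiv F G (c : R) : long_tailed F -> 0 < c ->
  tail G x / tail F x @[x --> +oo] --> c -> long_tailed G.
Proof.
move=> FL c0 GF; have F0 := FL.1.
have Fgt0 x := tail_gt0 F x F0.
have G0 : positive_tail G.
  (* Positivity is inherited from a far point [y], where the ratio is close to [c > 0], by
     monotonicity of the tail. *)
  move=> x _; near (pinfty_nbhs R) => y.
  apply: (@lt_le_trans _ _ (tail G y)).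
    have : 0 < tail G y / tail F y.
      by near: y; exact: (cvgr_gt _ GF).
    by rewrite pmulr_lgt0// invr_gt0.
  by apply: tail_nonincreasing; near: y; apply: nbhs_pinfty_ge; exact: num_real.
have Ggt0 x := tail_gt0 G x G0.
split=> // y _.
rewrite -(@divff _ c) ?gt_eqF//.
apply: cvg_trans (cvgM (ratio_shift _ _ _ (- y) FL GF) (cvgV _ GF));
  last by rewrite gt_eqF.
apply: near_eq_cvg; near=> x.
by rewrite /= invf_div mulrA divfK// gt_eqF.
Unshelve. all: end_near. Qed.

Lemma subexponential_equiv F G (c : R) : subexponential F -> 0 < c ->
  tail G x / tail F x @[x --> +oo] --> c -> subexponential G.
Proof.
move=> FS c0 GF; have FL := FS.1.
have GL := long_tailed_equiv _ _ _ FL c0 GF; split => //.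
have Fgt0 x := tail_gt0 F x FL.1.
have -> : (2 : R) = (c + c) / c.
  by rewrite -mulr2n -mulr_natr; field; rewrite gt_eqF.
apply: cvg_trans (cvgM (convolution_tail_asymp _ _ _ _ _ FS GF GF) (cvgV _ GF));
  last by rewrite gt_eqF.
apply: near_eq_cvg; near=> x.
by rewrite /= invf_div mulrA divfK// gt_eqF.
Unshelve. all: end_near. Qed.

(** The limsup is an infimum of suprema over neighbourhoods of infinity, so being below 1 means that
    one such supremum is. *)
Lemma positively_decreasing_near F : positive_tail F ->
  positively_decreasing F <-> exists2 v, 1 < v & exists2 r, r < 1 &
    \forall x \near +oo, tail F (v * x) / tail F x <= r.
Proof.
move=> F0; split.
  move=> [_ [v v1]]; rewrite limf_esupE => /ereal_inf_lt[_ [V VF <-] Vlt1].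
  exists v => //.
  have [r Vr r1] : exists2 r, (ereal_sup
      [set (tail F (v * x) / tail F x)%:E | x in V] <= r%:E)%E & r < 1.
    move: Vlt1; case: ereal_sup => [s| |].
    - by rewrite lte_fin => s1; exists s.
    - by rewrite ltNge leey.
    - by exists 0 => //; rewrite leNye.
  exists r => //; apply: filterS VF => x Vx.
  rewrite -lee_fin; apply: le_trans Vr; apply: ereal_sup_ubound.
  by exists x.
move=> [v v1 [r r1 vr]]; split=> //; exists v => //.
apply: (@le_lt_trans _ _ r%:E); last by rewrite lte_fin.
rewrite limf_esupE; apply: (@le_trans _ _ (ereal_sup
    [set (tail F (v * x) / tail F x)%:E |
      x in [set x | tail F (v * x) / tail F x <= r]])).
  apply: ereal_inf_lbound.
  by exists [set x | tail F (v * x) / tail F x <= r].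
by apply: ge_ereal_sup => _ [x xr <-]; rewrite lee_fin.
Qed.

Lemma positively_decreasing_equiv F G (c : R) : positively_decreasing F ->
  positive_tail G -> 0 < c ->
  tail G x / tail F x @[x --> +oo] --> c -> positively_decreasing G.
Proof.
move=> FD G0 c0 GF; have F0 := FD.1.
have Fgt0 x := tail_gt0 F x F0.
have Ggt0 x := tail_gt0 G x G0.
have [v v1 [r0 r01 vr0]] := (positively_decreasing_near F F0).1 FD.
(* Raising [r0] to 1/2 keeps [1 + r] positive. Then [2 / (1 + r)] exceeds 1, leaving room for a
   factor tending to 1, while [2 * r / (1 + r)] is still below 1. *)
pose r := Num.max r0 (1 / 2).
have r1 : r < 1 by rewrite gt_max r01; lra.
have rge : 1 / 2 <= r by rewrite le_max lexx orbT.
have vr : \forall x \near +oo, tail F (v * x) / tail F x <= r.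
  by apply: filterS vr0 => x xr; rewrite le_max xr.
apply/(positively_decreasing_near G G0); exists v => //.
exists (2 / (1 + r) * r).
  by rewrite mulrAC ltr_pdivrMr; lra.
have vy : v * x @[x --> +oo] --> +oo.
  apply: gt0_cvgMry; first by lra.
  exact: cvg_id.
have h1 : tail G (v * x) / tail F (v * x) @[x --> +oo] --> c.
  exact: (cvg_comp _ _ vy GF).
have h2 : (tail G (v * x) / tail F (v * x)) * (tail G x / tail F x)^-1
    @[x --> +oo] --> (1 : R).
  rewrite -(@divff _ c) ?gt_eqF//; apply: cvgM => //.
  by apply: cvgV => //; rewrite gt_eqF.
near=> x.
have -> : tail G (v * x) / tail G x = (tail G (v * x) / tail F (v * x)) *
    (tail G x / tail F x)^-1 * (tail F (v * x) / tail F x).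
  by field; rewrite !gt_eqF.
apply: ler_pM.
- by rewrite mulr_ge0// ?invr_ge0 divr_ge0// ltW.
- by rewrite divr_ge0// ltW.
- near: x; apply: (cvgr_le _ h2).
  by rewrite ltr_pdivlMr; lra.
- by near: x.
Unshelve. all: end_near. Qed.

Lemma class_A_equiv F G (c : R) : class_A F -> 0 < c ->
  tail G x / tail F x @[x --> +oo] --> c -> class_A G.
Proof.
move=> [FS FD] c0 GF; have GS := subexponential_equiv F G c FS c0 GF.
by split=> //; apply: positively_decreasing_equiv FD GS.1.1 c0 GF.
Qed.

End Asymptotics.

(** * Laws of partial sums and of the random sum *)

Section Sums.
Context {d : measure_display} {T : measurableType d} {R : realType}.
Variable P : probability T R.
Implicit Types X : nat -> {RV P >-> R}.

(** The zeroth power is the point mass at 0, the law of the empty sum. *)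
Fixpoint conv_power (F : probability R R) (n : nat) : probability R R :=
  if n is m.+1 then convolution F (conv_power F m)
  else (\d_(0 : R) : probability R R).

Definition psum X (n : nat) (w : T) : R := \sum_(i < n) X i w.

Lemma measurable_psum X n : measurable_fun [set: T] (psum X n).
Proof. by apply: measurable_sum => i; exact: measurable_funP. Qed.

Lemma measurable_psum_preimage X n (A : set R) :
  measurable A -> measurable (psum X n @^-1` A).
Proof.
by move=> mA; rewrite -[X in measurable X]setTI; exact: measurable_psum.
Qed.

Lemma measurable_RV_preimage (Y : {RV P >-> R}) (A : set R) :
  measurable A -> measurable (Y @^-1` A).
Proof.
by move=> mA; rewrite -[X in measurable X]setTI; exact: measurable_funP.
Qed.

Lemma psumS X n w : psum X n.+1 w = X n w + psum X n w.
Proof. by rewrite /psum big_ord_recr/= addrC. Qed.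

Lemma measurable_cylinder X (J : {fset nat}) (B : nat -> set R) :
  (forall i, measurable (B i)) ->
  measurable (\bigcap_(i in [set` J]) (X i @^-1` B i)).
Proof.
move=> mB; apply: bigcap_measurableType => // i _.
exact: measurable_RV_preimage.
Qed.

(* Carrying along an event D about later variables makes the induction go
   through: restricted to D, the pair (X k, psum X k) has law P(D) times the
   product of F and the k-th power. *)
Lemma psum_independent X (F : probability R R) (k : nat) (J : {fset nat})
    (B : nat -> set R) (A : set R) :
  mutually_independent X ->
  (forall i (B : set R), measurable B -> distribution P (X i) B = F B) ->
  (forall i, measurable (B i)) -> measurable A ->
  (forall i, i \in J -> (k <= i)%N) ->
  P ((psum X k @^-1` A) `&` \bigcap_(i in [set` J]) (X i @^-1` B i)) =
  (conv_power F k A * P (\bigcap_(i in [set` J]) (X i @^-1` B i)))%E.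
Proof.
move=> Xi XF; elim: k J B A => [|k IH] J B A mB mA kJ.
  rewrite /= diracE; have -> : psum X 0 @^-1` A = [set w | A 0].
    by apply/seteqP; split=> w; rewrite /psum /= big_ord0.
  case: (boolP (0 \in A)); rewrite ?inE => A0.
    rewrite mul1e; congr (P _); apply/seteqP; split=> w; first by case.
    by split.
  rewrite mul0e (_ : _ `&` _ = set0) ?measure0//.
  by apply/seteqP; split=> w // [/= H]; move: A0; rewrite notin_setE.
set D := \bigcap_(i in [set` J]) (X i @^-1` B i).
have mD : measurable D by exact: measurable_cylinder.
pose pr (w : T) : R * R := (X k w, psum X k w).
have mpr : measurable_fun [set: T] pr.
  apply/measurable_fun_pairP; split; first exact: measurable_funP.
  exact: measurable_psum.
have PD0 : 0 <= fine (P D) by rewrite fine_ge0.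
pose m0 := pushforward (mrestr P mD) pr : {measure set (R * R) -> \bar R}.
pose m' : {measure set (R * R) -> \bar R} := m0 mpr.
pose m2 := mscale (NngNum PD0) (conv_power F k).
have m'E C1 C2 : measurable C1 -> measurable C2 ->
    m' (C1 `*` C2) = (F C1 * m2 C2)%E.
  move=> mC1 mC2.
  (* The condition on [X k] joins the later variables: [k] is added to [J], and the induction
     hypothesis at [k] applies to the larger event. *)
  pose J' := (k |` J)%fset.
  pose B' i := if i == k then C1 else B i.
  have kNJ : k \notin J by apply/negP => /kJ; rewrite ltnn.
  have mB' i : measurable (B' i) by rewrite /B'; case: ifP.
  have DE : \bigcap_(i in [set` J']) (X i @^-1` B' i) = (X k @^-1` C1) `&` D.
    apply/seteqP; split=> w /=.
      move=> H; split.
        by have := H k; rewrite /= /B' eqxx; apply; rewrite !inE eqxx.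
      move=> i iJ; have := H i; rewrite /= /B'.
      have [ik|ik] := eqVneq i k; first by move: kNJ; rewrite -ik iJ.
      by apply; rewrite !inE iJ orbT.
    move=> [H1 H2] i; rewrite /= /B' !inE.
    by have [->//|ik /= iJ] := eqVneq i k; exact: H2.
  have kJ' i : i \in J' -> (k <= i)%N.
    by rewrite !inE => /orP[/eqP->//|/kJ/ltnW].
  have := IH J' B' C2 mB' mC2 kJ'.
  rewrite (Xi _ _ mB') DE big_fsetU1//= {1}/B' eqxx.
  rewrite [X in (_ * (_ * X))%E](_ : _ = P D); last first.
    rewrite Xi//; apply: eq_big_seq => i iJ; rewrite /B' ifN//.
    by apply: contraNneq kNJ => <-.
  have -> : P (X k @^-1` C1) = F C1 by rewrite -(XF k).
  rewrite /m' /m2 /= /pushforward /mrestr /mscale /= fineK ?fin_num_measure//.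
  move=> H.
  rewrite muleA muleC -H; congr (P _); apply/seteqP; split=> w /=.
    by move=> [[? ?] ?].
  by move=> [? [? ?]].
have sE : psum X k.+1 @^-1` A = pr @^-1` (sum_pair @^-1` A).
  by apply/seteqP; split=> w /=; rewrite psumS.
have mS : measurable (sum_pair @^-1` A : set (R * R)).
  by rewrite -[X in measurable X]setTI; exact: measurable_sum_pair.
have -> : P (psum X k.+1 @^-1` A `&` D) = m' (sum_pair @^-1` A) by rewrite sE.
(* Agreement on rectangles determines the measure, which is then evaluated on the preimage of [A]
   under addition, giving the convolution. *)
rewrite -(product_measure_unique m'E)//.
rewrite /product_measure1 /m2 /mscale /= ge0_integralZl//; last first.
  exact: measurable_fun_xsection.
by rewrite fineK ?fin_num_measure// muleC.
Qed.

Lemma distribution_psum X (F : probability R R) k (A : set R) :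
  mutually_independent X ->
  (forall i (B : set R), measurable B -> distribution P (X i) B = F B) ->
  measurable A -> P (psum X k @^-1` A) = conv_power F k A.
Proof.
move=> Xi XF mA.
have := psum_independent X F k fset0 (fun=> setT) A Xi XF
  (fun=> measurableT) mA.
rewrite (_ : \bigcap_(i in _) _ = setT); last first.
  by apply/seteqP; split=> w // _ i /=; rewrite inE.
by rewrite setIT probability_setT mule1; apply=> i; rewrite inE.
Qed.

(** Each [X i] is measurable for the generated sigma-algebra, hence so are finite sums. This brings
    partial sums under the independence of [N] from the sequence. *)
Lemma sigma_seq_psum X n (A : set R) : measurable A ->
  sigma_seq X (psum X n @^-1` A).
Proof.
move=> mA.
pose G := \bigcup_i preimage_set_system [set: T] (X i) measurable.
have mX i : measurable_fun [set: g_sigma_algebraType G]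
    (X i : g_sigma_algebraType G -> R).
  move=> _ B mB; apply: sub_sigma_algebra; exists i => //.
  by exists B.
have : measurable_fun [set: g_sigma_algebraType G]
    (psum X n : g_sigma_algebraType G -> R) by apply: measurable_sum => i.
by move=> /(_ measurableT A mA); rewrite setTI.
Qed.

Lemma measurable_comp_nat_RV (N : {RV P >-> nat}) (h : nat -> \bar R) :
  measurable_fun [set: T] (fun w => h (N w)).
Proof. exact: (@measurableT_comp _ _ _ _ _ _ h). Qed.

Lemma ge0_integral_nat_RV (N : {RV P >-> nat}) (h : nat -> \bar R) :
  (forall n, 0 <= h n)%E ->
  (\int[P]_w h (N w) = \sum_(0 <= n <oo) h n * P (N @^-1` [set n]))%E.
Proof.
move=> h0.
have mN n : measurable (N @^-1` [set n]).
  by rewrite -[X in measurable X]setTI; exact: measurable_funP.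
have NT : \bigcup_n (N @^-1` [set n]) = setT.
  by apply/seteqP; split=> w // _; exists (N w).
rewrite -NT ge0_integral_bigcup//.
- apply: eq_eseriesr => n _.
  rewrite (eq_integral (fun=> h n)); last by move=> w; rewrite inE /= => ->.
  by rewrite integral_cst.
- by rewrite NT; exact: measurable_comp_nat_RV.
- by move=> m n _ _ [w [/= <- <-]].
Qed.

(** On [N = n] the random sum is the [n]-th partial sum; independence factors each term, and the
    series is an expectation over [N]. *)
Lemma tail_random_sum X N (F : probability R R) x :
  mutually_independent X ->
  (forall i (B : set R), measurable B -> distribution P (X i) B = F B) ->
  independent_of_seq N X ->
  (tail (distribution P (random_sum X N)) x)%:E =
  (\int[P]_w (tail (conv_power F (N w)) x)%:E)%E.
Proof.
move=> Xi XF NX.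
rewrite (ge0_integral_nat_RV N (fun n => (tail (conv_power F n) x)%:E));
  last by move=> n; rewrite lee_fin tail_ge0.
rewrite tailE; set B := `]x, +oo[%classic.
transitivity (P (random_sum X N @^-1` B)); first by [].
have mB : measurable B by exact: measurable_itv.
have mN n : measurable (N @^-1` [set n]).
  by rewrite -[X in measurable X]setTI; exact: measurable_funP.
have -> : random_sum X N @^-1` B =
    \bigcup_n (N @^-1` [set n] `&` psum X n @^-1` B).
  apply/seteqP; split=> [w Bw|w [n _ [<-]]//].
  by exists (N w).
rewrite measure_semi_bigcup//; last 3 first.
- by move=> n; apply: measurableI => //; exact: measurable_psum_preimage.
- by move=> m n _ _ [w [[<- _] [<- _]]].
- apply: bigcup_measurable => n _.
  by apply: measurableI => //; exact: measurable_psum_preimage.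
apply: eq_eseriesr => n _.
rewrite [LHS](NX [set n] _ (sigma_seq_psum X n B mB)).
by rewrite (distribution_psum X F)// tailE muleC.
Qed.

(** [N] is at least the indicator of [N != 0], an event of positive probability. *)
Lemma expectation_nat_gt0 (N : {RV P >-> nat}) :
  (P [set w | N w = 0%N] < 1)%E -> (0 < 'E_P[fun w => (N w)%:R%R])%E.
Proof.
move=> N0.
have mN : measurable (N @^-1` [set 0%N]).
  by rewrite -[X in measurable X]setTI; exact: measurable_funP.
apply: (@lt_le_trans _ _ (P (~` (N @^-1` [set 0%N])))).
  by rewrite probability_setC// sube_gt0.
rewrite unlock -[X in P X]setIT -integral_indic//; last exact: measurableC.
apply: ge0_le_integral => //.
- by apply/measurable_EFinP; apply: measurable_indic; exact: measurableC.
- exact: (measurable_comp_nat_RV N (fun n => n%:R%:E)).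
move=> w _; rewrite lee_fin indicE; case: (boolP (w \in _)) => //.
by rewrite inE /= => /eqP; rewrite -lt0n ler1n.
Qed.

End Sums.

(** * Convolution powers: asymptotics and Kesten's bound *)

Section ConvolutionPowers.
Context {R : realType}.
Implicit Types F : probability R R.

Lemma tail_dirac0 (x : R) : 0 <= x -> tail (\d_(0 : R) : probability R R) x = 0.
Proof.
move=> x0; apply: EFin_inj; rewrite tailE; etransitivity; first exact: diracE.
by rewrite memNset//= in_itv/= andbT ltNge x0.
Qed.

Lemma tail_conv_power_asymp F n : subexponential F ->
  tail (conv_power F n) x / tail F x @[x --> +oo] --> (n%:R : R).
Proof.
move=> FS; have F0 := FS.1.1; have Fgt0 x := tail_gt0 F x F0.
elim: n => [|n IH].
  apply: cvg_near_cst; near=> x.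
  by rewrite /conv_power tail_dirac0 ?mul0r.
rewrite -natr1 addrC; apply: convolution_tail_asymp FS _ IH.
under eq_fun do rewrite divff ?gt_eqF//.
exact: cvg_cst.
Unshelve. all: end_near. Qed.

Lemma kesten_bound F (e : R) : subexponential F -> 0 < e ->
  exists2 K, 0 <= K & forall n x,
    tail (conv_power F n) x <= K * (1 + e) ^+ n * tail F x.
Proof.
move=> FS e0; have F0 := FS.1.1; have Fgt0 x := tail_gt0 F x F0.
(* [K (1 + e) ^+ n - b] with [b = C / e] solves [a_(n+1) = C + (1 + e) a_n]. *)
have [C C0 step] := kesten_step F e FS e0.
pose b := C / e; have b0 : 0 <= b by rewrite divr_ge0// ltW.
(* The first term settles [n = 0]: the point mass has zero tail for [x >= 0], and for [x < 0] its
   tail is at most 1 while [tail F x >= tail F 0]. *)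
pose K := (tail F 0)^-1 + b.
have K0 : 0 <= K by rewrite addr_ge0// invr_ge0 ltW.
have Kn n : K <= K * (1 + e) ^+ n.
  by rewrite ler_peMr// exprn_ege1//; lra.
have bK : b <= K by rewrite lerDr invr_ge0 ltW.
suff bound n x : tail (conv_power F n) x <= (K * (1 + e) ^+ n - b) * tail F x.
  exists K => // n x; apply: (le_trans (bound n x)).
  by apply: ler_wpM2r; [exact: ltW|lra].
elim: n x => [|n IH] x.
  rewrite expr0 mulr1 /K addrK mulrC ler_pdivlMr//.
  have [x0|x0] := leP 0 x; first by rewrite tail_dirac0// mul0r ltW.
  apply: (@le_trans _ _ (1 * tail F 0)).
    by apply: ler_wpM2r; [exact: ltW|exact: tail_le1].
  by rewrite mul1r tail_nonincreasing// ltW.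
have an : 0 <= K * (1 + e) ^+ n - b by have := Kn n; lra.
apply: (le_trans (step (conv_power F n) _ an IH x)).
suff -> : C + (1 + e) * (K * (1 + e) ^+ n - b) = K * (1 + e) ^+ n.+1 - b by [].
by rewrite exprS (_ : C = b * e); [ring|rewrite divfK// gt_eqF].
Qed.

End ConvolutionPowers.

(** * Dominated convergence over the law of [N], and the conclusion *)

Lemma tail_random_sum_asymp (R : realType) (d : measure_display)
  (T : measurableType d) (P : probability T R) (F : probability R R)
  (X : nat -> {RV P >-> R}) (N : {RV P >-> nat}) :
  mutually_independent X ->
  (forall i (B : set R), measurable B -> distribution P (X i) B = F B) ->
  subexponential F -> independent_of_seq N X ->
  ('E_P[fun w => (N w)%:R%R] < +oo)%E ->
  (exists2 delta : R, 0 < delta &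
    ('E_P[fun w => ((1 + delta) ^+ N w)%R] < +oo)%E) ->
  tail (distribution P (random_sum X N)) x / tail F x @[x --> +oo] -->
    fine 'E_P[fun w => (N w)%:R%R].
Proof.
move=> Xi XF FS NX EN [e e0 Ee].
have F0 := FS.1.1; have Fgt0 x := tail_gt0 F x F0.
(* Taking the growth rate from the exponential moment of [N] makes the dominating function
   [K * (1 + e) ^+ N] integrable. *)
have [K K0 bound] := kesten_bound F e FS e0.
have FNE x : (tail (distribution P (random_sum X N)) x / tail F x)%:E =
    (\int[P]_w (tail (conv_power F (N w)) x / tail F x)%:E)%E.
  rewrite EFinM (tail_random_sum P X N F)//.
  rewrite -ge0_integralZr//.
  - exact: (measurable_comp_nat_RV P N (fun n => (tail (conv_power F n) x)%:E)).
  - by move=> w _; rewrite lee_fin tail_ge0.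
  - by rewrite lee_fin invr_ge0 ltW.
(* Dominated convergence concerns sequences, so the limit is tested along an arbitrary [u] tending
   to infinity. *)
apply/cvg_pinftyP => u uy.
suff : ((tail (distribution P (random_sum X N)) (u n) / tail F (u n))%:E
    @[n --> \oo] --> (fine 'E_P[fun w => (N w)%:R%R])%:E)%E.
  by move=> /fine_cvg.
rewrite fineK; last first.
  by rewrite ge0_fin_numE// expectation_ge0// => w; rewrite ler0n.
under eq_fun do rewrite FNE.
rewrite unlock.
apply: (@dominated_cvg _ _ _ P setT measurableT
  (fun n w => (tail (conv_power F (N w)) (u n) / tail F (u n))%:E)
  (fun w => (N w)%:R%:E) (fun w => (K * (1 + e) ^+ N w)%:E)) => //.
- by move=> n; exact: (measurable_comp_nat_RV P N
    (fun m => (tail (conv_power F m) (u n) / tail F (u n))%:E)).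
- move=> w _; apply: cvg_EFin; first by near=> n.
  exact: (cvg_comp _ _ uy (tail_conv_power_asymp F (N w) FS)).
- apply/integrableP; split.
    exact: (measurable_comp_nat_RV P N (fun n => (K * (1 + e) ^+ n)%:E)).
  under eq_integral => w _.
    rewrite gee0_abs; last by rewrite lee_fin mulr_ge0// exprn_ge0//; lra.
    rewrite EFinM; over.
  rewrite ge0_integralZl//.
  + by rewrite lte_mul_pinfty//; move: Ee; rewrite unlock.
  + exact: (measurable_comp_nat_RV P N (fun n => ((1 + e) ^+ n)%:E)).
  + by move=> w _; rewrite lee_fin exprn_ge0//; lra.
- move=> n w _; rewrite gee0_abs ?lee_fin ?divr_ge0 ?tail_ge0//.
  by rewrite ler_pdivrMr.
Unshelve. all: end_near. Qed.

Theorem proposition3p3 (R : realType) (d : measure_display)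
  (T : measurableType d) (P : probability T R)
  (F : probability R R)
  (X : nat -> {RV P >-> R}) (N : {RV P >-> nat})
  (X_indep : mutually_independent X)
  (X_distr : forall (i : nat) (B : set R), measurable B ->
    distribution P (X i) B = F B)
  (F_A : class_A F)
  (N_not0 : (P [set w | N w = 0%N] < 1)%E)
  (N_indep : independent_of_seq N X)
  (N_mean : ('E_P[fun w => (N w)%:R%R] < +oo)%E)
  (N_exp : exists2 delta : R, 0 < delta &
    ('E_P[fun w => ((1 + delta) ^+ N w)%R] < +oo)%E) :
  asymp_equiv (tail (distribution P (random_sum X N)))
    (fun x => fine 'E_P[fun w => (N w)%:R%R] * tail F x) /\
  class_A (distribution P (random_sum X N)).
Proof.
have [FS FD] := F_A.
have Fgt0 x := tail_gt0 F x FS.1.1.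
have GF := tail_random_sum_asymp R d T P F X N X_indep X_distr FS N_indep
  N_mean N_exp.
(* A positive mean is what allows division by it and makes the tail of the sum equivalent to a
   positive multiple of that of [F]. *)
have EN0 : 0 < fine 'E_P[fun w => (N w)%:R%R].
  by rewrite fine_gt0// N_mean andbT; exact: expectation_nat_gt0.
split; last exact: class_A_equiv F_A EN0 GF.
set c := fine _ in EN0 GF *.
rewrite /asymp_equiv -(@divff _ c) ?gt_eqF//.
have : tail (distribution P (random_sum X N)) x / tail F x * c^-1
    @[x --> +oo] --> c / c by apply: cvgM => //; exact: cvg_cst.
apply: cvg_trans; apply: near_eq_cvg; near=> x.
by field; rewrite !gt_eqF.
Unshelve. all: end_near. Qed.
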